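(* Let $\lambda:\mathbb{Z}_+\to[0,\infty)$ with $\lambda(0)>0$ and $\mu_1,\mu_2>0$. Assume $\mu_1<\mu_2$, and let $Z\sim\operatorname{geom}(\mu_1/\mu_2)$. Then $$\mathrm{E}\,\lambda(Z)<\mu_1 \implies S(\lambda,\mu_1,\mu_2)\text{ is stable},$$ $$\mathrm{E}\,\lambda(Z)>\mu_1 \implies S(\lambda,\mu_1,\mu_2)\text{ is unstable (i.e. not stable)}.$$
   Context: $\mathbb{Z}_+=\{0,1,2,\dots\}$ and $e_1,e_2$ are the unit vectors of $\mathbb{Z}_+^2$. The system $S(\lambda,\mu_1,\mu_2)$ (for a nonnegative function $\lambda$ on $\mathbb{Z}_+$ and $\mu_1,\mu_2>0$) is the set of transition rates $q(x,y)$, $x\ne y$, $x,y\in\mathbb{Z}_+^2$, given by $q(x,x+e_1)=\lambda(x_2)$; $q(x,x-e_1+e_2)=\mu_1$ if $x_1\ge1$; $q(x,x-e_2)=\mu_2$ if $x_2\ge 1$; and $q(x,y)=0$ otherwise. Set $q(x)=\sum_{y\ne x}q(x,y)<\infty$ and $q(x,x)=-q(x)$. These rates define, by the minimal construction, a unique continuous-time Markov process $X=(X_1,X_2)$ on $\mathbb{Z}_+^2\cup\{\kappa\}$, where $\kappa$ is an extra state entered at the explosion time. The system is called stable if this Markov process is ergodic, that is, irreducible and positive recurrent (on $\mathbb{Z}_+^2$). For $0\le z<1$, $Z\sim\operatorname{geom}(z)$ means that $Z$ takes values in $\mathbb{Z}_+$ with $\mathrm{P}(Z=j)=(1-z)z^j$.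 The expectation $\mathrm{E}\,\lambda(Z)$ takes values in $[0,\infty]$. *)

(* Defs.v *)
From HB Require Import structures.
From mathcomp Require Import all_boot all_order all_algebra.
From mathcomp Require Import all_classical all_reals all_analysis.
From mathcomp Require Import measurable_realfun.

Set Implicit Arguments.
Unset Strict Implicit.
Unset Printing Implicit Defensive.
Import Order.TTheory GRing.Theory Num.Theory.
Import numFieldNormedType.Exports.
Local Open Scope classical_set_scope.
Local Open Scope ring_scope.

Section Rates.
Variables (R : realType) (V : countType) (q : V -> V -> R).

(* q x y is read for x <> y only. *)
Definition total_rate (x : V) : R :=
  fine (\esum_(y in [set y | y <> x]) (q x y)%:E).

(* Absorbing states (total rate 0) are given a self-loop. *)
Definition jump_prob (x y : V) : R :=
  if total_rate x == 0 then (x == y)%:R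
  else if x == y then 0 else q x y / total_rate x.

(* The minimal construction: under law x, the jump chain starts at x and is
   Markov with transition matrix jump_prob and, conditionally on it, the holding
   times are independent, exponential with parameters total_rate (chain k)
   (infinite when this parameter is 0).  This determines the law of the pair
   (chain, holding) under each law x. *)
Record minimal_process := MinimalProcess {
  disp : measure_display ;
  Omega : measurableType disp ;
  law : V -> probability Omega R ;
  chain : nat -> Omega -> V ;
  holding : nat -> Omega -> \bar R ;
  measurable_chain : forall n y, measurable [set w | chain n w = y] ;
  measurable_holding : forall n, measurable_fun setT (holding n) ;
  holding_gt0 : forall n w, (0 < holding n w)%E ;
  finite_dim_law : forall (x : V) (n : nat) (y : nat -> V) (t : nat -> R),
    (forall k, 0 <= t k) ->
    law x [set w | forall k, (k <= n)%N ->
             chain k w = y k /\ ((t k)%:E < holding k w)%E]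
    = ((y 0%N == x)%:R
       * \prod_(0 <= k < n) jump_prob (y k) (y k.+1)
       * \prod_(0 <= k < n.+1) expR (- (total_rate (y k) * t k)))%:E }.

End Rates.

Arguments law {R V q} m x.
Arguments chain {R V q} m n w.
Arguments holding {R V q} m n w.

Section Process.
Variables (R : realType) (V : countType) (q : V -> V -> R).
Variable X : minimal_process q.

Definition jump_time (n : nat) (w : Omega X) : \bar R :=
  (\sum_(0 <= k < n) holding X k w)%E.

(* None is the extra state, in which the process stays from the explosion time
   on; the index n, when it exists, is unique since holding times are > 0. *)
Definition state (t : R) (w : Omega X) : option V :=
  match pselect (exists n, (jump_time n w <= t%:E < jump_time n.+1 w)%E) with
  | left ex_n => Some (chain X (ex_minn ex_n) w)
  | right _ => None
  end.

Definition irreducible : Prop :=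
  forall x y : V, exists t : R,
    0 <= t /\ (0 < law X x [set w | state t w = Some y])%E.

(* Equal to +oo if x is not visited after the first jump. *)
Definition return_time (x : V) (w : Omega X) : \bar R :=
  ereal_inf [set t%:E | t in
    [set t : R | (jump_time 1 w <= t%:E)%E /\ state t w = Some x]].

Definition positive_recurrent (x : V) : Prop :=
  total_rate q x = 0 \/ (\int[law X x]_w return_time x w < +oo)%E.

Definition ergodic : Prop := irreducible /\ forall x : V, positive_recurrent x.

End Process.

Definition tandem_rate (R : realType) (lambda : nat -> R) (mu1 mu2 : R)
    (x y : nat * nat) : R :=
  if y == (x.1.+1, x.2) then lambda x.2
  else if (1 <= x.1)%N && (y == (x.1.-1, x.2.+1)) then mu1
  else if (1 <= x.2)%N && (y == (x.1, x.2.-1)) then mu2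
  else 0.

(* The law of X is determined by the rates, hence so is its ergodicity. *)
Definition stable (R : realType) (lambda : nat -> R) (mu1 mu2 : R)
    (X : minimal_process (tandem_rate lambda mu1 mu2)) : Prop :=
  ergodic X.

Definition geom (R : realType) (z : R) (d : measure_display)
    (T : measurableType d) (P : probability T R) (Z : {RV P >-> nat}) : Prop :=
  forall j : nat, P [set w | Z w = j] = ((1 - z) * z ^+ j)%:E.

(* Main.v *)
Require Import Defs.
From mathcomp Require Import all_boot all_order all_algebra.
From mathcomp Require Import all_classical all_reals all_analysis.
From mathcomp Require Import measurable_realfun ring lra zify.
Import Order.TTheory GRing.Theory Num.Theory.
Import numFieldNormedType.Exports.

(** While the first queue is busy, the second is an M/M/1 queue with arrival rate
    [mu1] and service rate [mu2], in equilibrium distributed as [Z]; the first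
    queue then grows at mean rate [E lambda(Z)] and shrinks at rate [mu1].  Both
    implications turn this averaging into a function with a drift of known sign,
    by solving the Poisson equation of the M/M/1 queue (section
    [PoissonIncrements]), whose solvability with the right growth is where the
    sign of [E lambda(Z) - mu1] enters.

    Below the threshold, [tandem_stable] takes [x1 + g(x2)], up to a constant,
    where [g] solves the equation for slightly inflated arrival rates.  The
    inflation makes the drift proportional to the total rate, so that already
    the number of jumps before a return has finite mean, and makes [g] grow at
    least linearly, so that the boundary [x1 = 0] is harmless outside a finite
    set.  Such a drift condition implies ergodicity for any rates that connect
    all states, have finitely many successors and total rates bounded below,
    by [foster_ergodic].  Its proof replaces the
    finite exceptional set by a single arbitrary state [z], adding a multiple of
    the truncated mean hitting time of [z] ([foster_single_state]); the drift
    then bounds the mean number of jumps before a return to [z], and with it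
    the mean return time ([foster_positive_recurrent]).

    Above the threshold, [tandem_unstable] truncates [lambda] to finitely many
    values without losing the strict inequality, and takes an exponential
    perturbation of the solution, small and positive, which is superharmonic
    off a finite set and falls below its minimum there.  A chain started where
    the function is that small avoids the finite set forever with positive
    probability, and the empty state, which lies in that set, leads there without
    returning; hence its mean return time is infinite
    ([superharmonic_not_positive_recurrent]).

    Return probabilities of the jump chain come from [follow_avoid_law], which
    expresses the probability of following a path and then avoiding a state by
    the real recursion [taboo].  Integrals of the return time are compared with
    those of measurable functions by [ge0_integral_mono]; the return time itself
    is bounded by a double series of indicators that diverges by itself when
    there is no return ([return_time_le_series]). *)

Set Implicit Arguments.
Unset Strict Implicit.
Unset Printing Implicit Defensive.
Local Open Scope classical_set_scope.
Local Open Scope ring_scope.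

(** * Elementary estimates *)

Lemma dominating_constant (R : realType) (T : eqType) (s : seq T)
    (c d : T -> R) :
  (forall x, x \in s -> 0 < d x) ->
  exists2 M : R, 0 <= M & forall x, x \in s -> c x <= M * d x.
Proof.
elim: s => [|a s IHs] d_gt0; first by exists 0.
have [|M M_ge0 leM] := IHs.
  by move=> x xs; apply: d_gt0; rewrite inE xs orbT.
have da : 0 < d a by apply: d_gt0; rewrite mem_head.
exists (M + `|c a| / d a) => [|x].
  by rewrite addr_ge0 // divr_ge0 // ltW.
rewrite inE => /predU1P[->|xs]; rewrite mulrDl.
  by rewrite divfK ?gt_eqF // ler_wpDl ?ler_norm // mulr_ge0 // ltW.
apply: ler_wpDr; last exact: leM.
by rewrite mulr_ge0 ?divr_ge0 // ltW // d_gt0 // inE xs orbT.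
Qed.

Lemma common_threshold (R : realType) (T : eqType) (s : seq T)
    (P : T -> R -> Prop) :
  (forall x, x \in s ->
    exists2 d, 0 < d & forall t, 0 < t -> t <= d -> P x t) ->
  exists2 d, 0 < d & forall x, x \in s -> forall t, 0 < t -> t <= d -> P x t.
Proof.
elim: s => [|a s IHs] Ps; first by exists 1.
have [d1 d1_gt0 P1] := Ps a (mem_head _ _).
have [|d2 d2_gt0 P2] := IHs.
  by move=> x xs; apply: Ps; rewrite inE xs orbT.
exists (Num.min d1 d2) => [|x]; first by rewrite lt_min d1_gt0.
rewrite inE => /predU1P[->|xs] t t_gt0; rewrite le_min => /andP[t1 t2].
  exact: P1.
exact: P2.
Qed.

Lemma cubic_neg_near0 (R : realType) (p0 p1 p2 p3 : R) : p0 < 0 ->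
  exists2 d, 0 < d & forall t, 0 < t -> t <= d ->
    p0 + p1 * t + p2 * t ^+ 2 + p3 * t ^+ 3 < 0.
Proof.
move=> p0_lt0; pose C := `|p1| + `|p2| + `|p3| + 1.
have C_gt0 : 0 < C by rewrite ltr_wpDl // !addr_ge0.
exists (Num.min 1 (- p0 / (2 * C))).
  by rewrite lt_min ltr01 divr_gt0 ?oppr_gt0 // mulr_gt0.
move=> t t_gt0; rewrite le_min => /andP[t1 tp].
have tC : t * C <= - p0 / 2.
  by move: tp; rewrite invfM mulrA ler_pdivlMr.
have bound (p s : R) : 0 <= s -> s <= t -> p * s <= `|p| * t.
  move=> s_ge0 st; apply: le_trans (ler_norm _) _.
  by rewrite normrM (ger0_norm s_ge0) ler_wpM2l.
have t2 : t ^+ 2 <= t by rewrite expr2 ler_piMl // ltW.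
have t3 : t ^+ 3 <= t.
  by apply: le_trans t2; rewrite exprS ler_piMl // exprn_ge0 // ltW.
have b1 := bound p1 t (ltW t_gt0) (lexx t).
have b2 := bound p2 _ (exprn_ge0 2 (ltW t_gt0)) t2.
have b3 := bound p3 _ (exprn_ge0 3 (ltW t_gt0)) t3.
have E : t * C = `|p1| * t + `|p2| * t + `|p3| * t + t by rewrite /C; ring.
lra.
Qed.

Lemma expr_small (R : realType) (x b : R) : 0 <= x < 1 -> 0 < b ->
  exists n, x ^+ n < b.
Proof.
case/andP=> x_ge0 x_lt1 b_gt0.
have /cvgrPdist_lt /(_ b b_gt0) [n _ nb] : x ^+ n @[n --> \oo] --> (0 : R).
  by apply: cvg_expr; rewrite ger0_norm.
exists n; have := nb n (leqnn n).
by rewrite sub0r normrN normrX ger0_norm.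
Qed.

Lemma nneseries_le_bound (R : realType) (u : nat -> \bar R) (M : \bar R) :
  (forall k, 0 <= u k)%E -> (forall n, \sum_(0 <= k < n) u k <= M)%E ->
  (\sum_(k <oo) u k <= M)%E.
Proof.
move=> u_ge0 uM; apply: lime_le; first exact: is_cvg_nneseries.
by apply: nearW => n; apply: uM.
Qed.

(** Monotonicity of the integral as the supremum over simple functions below,
    which requires no measurability. *)
Lemma ge0_integral_mono d (T : measurableType d) (R : realType)
    (mu : {measure set T -> \bar R}) (f g : T -> \bar R) :
  (forall w, 0 <= f w)%E -> (forall w, f w <= g w)%E ->
  (\int[mu]_w f w <= \int[mu]_w g w)%E.
Proof.
move=> f_ge0 fg; have g_ge0 w : (0 <= g w)%E := le_trans (f_ge0 w) (fg w).
rewrite !ge0_integralTE //; apply: ge_ereal_sup => _ [h hf <-].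
by apply: ereal_sup_ubound; exists h => // w; exact: le_trans (hf w) (fg w).
Qed.

(** * Means, survival probabilities and drift of a transition matrix *)

Section Means.
Variables (R : realType) (V : eqType) (p : V -> V -> R) (succ : V -> seq V).
Hypothesis p_ge0 : forall x y, 0 <= p x y.
Hypothesis sum_p : forall x, \sum_(y <- succ x) p x y = 1.

Definition mean (f : V -> R) (x : V) : R := \sum_(y <- succ x) p x y * f y.

Lemma le_mean f g x : (forall y, f y <= g y) -> mean f x <= mean g x.
Proof. by move=> fg; apply: ler_sum => y _; rewrite ler_wpM2l. Qed.

Lemma lt_mean f g x y : (forall v, f v <= g v) ->
  y \in succ x -> 0 < p x y -> f y < g y -> mean f x < mean g x.
Proof.
move=> fg ys p_gt0 fgy; rewrite /mean (big_rem _ ys) [ltRHS](big_rem _ ys) /=.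
by rewrite ltr_leD ?ltr_pM2l //; apply: ler_sum => v _; rewrite ler_wpM2l.
Qed.

Lemma mean_cst c x : mean (fun=> c) x = c.
Proof. by rewrite /mean -mulr_suml sum_p mul1r. Qed.

Lemma meanZ c f x : mean (fun y => c * f y) x = c * mean f x.
Proof. by rewrite /mean mulr_sumr; apply: eq_bigr => y _; rewrite mulrCA. Qed.

Lemma meanD f g x : mean (fun y => f y + g y) x = mean f x + mean g x.
Proof.
by rewrite /mean -big_split; apply: eq_bigr => y _; rewrite /= mulrDr.
Qed.

Lemma mean_sum n (f : nat -> V -> R) x :
  mean (fun y => \sum_(0 <= k < n) f k y) x = \sum_(0 <= k < n) mean (f k) x.
Proof.
rewrite /mean exchange_big; apply: eq_bigr => y _ /=.
by rewrite mulr_sumr.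
Qed.

Section Taboo.
Variable z : V.

(** [taboo f m x] is the mean of [f] at the [m]-th step from [x], restricted to
    the trajectories that stay off [z] at the steps 1 to [m]; for [f = 1] it is
    the probability of not being back at [z] within [m] steps. *)
Definition killed (f : V -> R) (y : V) : R := if y == z then 0 else f y.

Definition taboo (f : V -> R) (m : nat) : V -> R :=
  iter m (fun g => mean (killed g)) f.

Lemma tabooS f m x : taboo f m.+1 x = mean (killed (taboo f m)) x.
Proof. by []. Qed.

Lemma taboo_ge0 f m x : (forall y, 0 <= f y) -> 0 <= taboo f m x.
Proof.
move=> f_ge0; elim: m x => [|m IHm] x //.
rewrite tabooS -(mean_cst 0 x); apply: le_mean => y.
by rewrite /killed; case: ifP.
Qed.

Lemma taboo_leZ f g c m x :
  (forall y, f y <= c * g y) -> taboo f m x <= c * taboo g m x.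
Proof.
move=> fg; elim: m x => [|m IHm] x //.
rewrite !tabooS -meanZ; apply: le_mean => y.
by rewrite /killed; case: ifP; rewrite ?mulr0.
Qed.

Let surv m := taboo (fun=> 1) m.

Lemma taboo_le1 m x : surv m x <= 1.
Proof.
elim: m x => [|m IHm] x //; rewrite /surv tabooS -[leRHS](mean_cst 1 x).
by apply: le_mean => y; rewrite /killed; case: ifP.
Qed.

Lemma taboo_decr m x : surv m.+1 x <= surv m x.
Proof.
elim: m x => [|m IHm] x; first exact: taboo_le1.
apply: (@le_mean (killed (surv m.+1)) (killed (surv m))) => y; rewrite /killed.
by case: ifP => // _; apply: IHm.
Qed.

(** The chance of ever visiting [z] is the least nonnegative superharmonic
    function that is 1 at [z]. *)
Lemma taboo_superharmonic h m x : h z = 1 -> (forall y, 0 <= h y <= 1) ->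
  (forall y, mean h y <= h y) -> 1 - h x <= surv m x.
Proof.
move=> hz h01 sup; elim: m x => [|m IHm] x.
  by rewrite lerBlDr lerDl; case/andP: (h01 x).
rewrite /surv tabooS; apply: (@le_trans _ _ (1 - mean h x)).
  by rewrite lerD2l lerN2.
rewrite -[X in X - _](mean_cst 1 x) -mulN1r -meanZ -meanD.
apply: le_mean => y; rewrite mulN1r /killed.
by case: eqP => [->|_]; [rewrite hz subrr|apply: IHm].
Qed.

(** The sum is a truncated expectation of the time of the first return to [z],
    whose remaining mean duration is at most [U]. *)
Lemma sum_taboo_le (U : V -> R) N x : (forall y, 0 <= U y) ->
  (forall y, y != z -> mean U y <= U y - 1) ->
  \sum_(0 <= m < N) surv m x <= 1 + mean U x.
Proof.
move=> U_ge0 drift.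
have mU y : 0 <= mean U y by rewrite -(mean_cst 0 y); apply: le_mean.
elim: N x => [|N IHN] x; first by rewrite big_nil addr_ge0.
rewrite big_nat_recl //= lerD2l -mean_sum; apply: le_mean => y.
rewrite /killed; case: (boolP (y == z)) => yz; first by rewrite big1.
by apply: le_trans (IHN y) _; rewrite addrC -lerBrDr drift.
Qed.

Definition step (x y : V) : bool := (y \in succ x) && (0 < p x y).

(** A mean of numbers at most 1 is below 1 as soon as one of them is and carries
    positive weight, so that being below 1 propagates backwards along a path
    to [z]. *)
Lemma killed_taboo_lt1 x s : path step x s -> last x s = z ->
  killed (surv (size s)) x < 1.
Proof.
elim: s x => [x _ /= xz|y s IHs x /= /andP[/andP[ys p_gt0] ps] lz].
  by rewrite /killed xz eqxx ltr01.
rewrite /killed; case: ifP => _; first exact: ltr01.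
rewrite -[ltRHS](mean_cst 1 x).
apply: (@lt_mean (killed (surv (size s))) _ _ y) => // [v|]; last exact: IHs.
by rewrite /killed; case: ifP => // _; apply: taboo_le1.
Qed.

Lemma killed_taboo_decr m n x : (m <= n)%N ->
  killed (surv n) x <= killed (surv m) x.
Proof.
move=> /subnK <-; elim: (n - m)%N => // k IHk; rewrite addSn.
apply: le_trans IHk; rewrite /killed; case: ifP => // _; exact: taboo_decr.
Qed.

(** Off [z], the mean of the hitting time of [z] truncated at [n], the function
    [B] of the proof, has drift [-1] plus the probability of not having hit [z]
    in [n] steps: never positive, and negative wherever [z] is reachable in [n]
    steps.  A large multiple of it absorbs the finitely many states of [F]
    where [U] may fail to decrease. *)
Lemma foster_single_state (U : V -> R) (F : seq V) (e : R) :
  0 < e -> (forall y, 0 <= U y) ->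
  (forall y, y \notin F -> mean U y <= U y - e) ->
  (forall x, x \in F -> exists2 s, path step x s & last x s = z) ->
  exists2 W : V -> R, (forall y, 0 <= W y) &
    forall y, y != z -> mean W y <= W y - 1.
Proof.
move=> e_gt0 U_ge0 drift reach.
have [n n_lt1] : exists n, forall x, x \in F -> killed (surv n) x < 1.
  elim: F reach {drift} => [_|a F IHF reach]; first by exists 0%N.
  have [|n n_lt1] := IHF.
    by move=> x xF; apply: reach; rewrite inE xF orbT.
  have [s ps ls] := reach a (mem_head _ _).
  exists (maxn n (size s)) => x; rewrite inE => /predU1P[->|xF].
    apply: le_lt_trans (killed_taboo_lt1 ps ls).
    exact/killed_taboo_decr/leq_maxr.
  apply: le_lt_trans (n_lt1 x xF).
  exact/killed_taboo_decr/leq_maxl.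
have [|M M_ge0 leM] := @dominating_constant _ _ F (fun x => mean U x - U x + e)
  (fun x => 1 - killed (surv n) x).
  by move=> x xF; rewrite subr_gt0 n_lt1.
pose B y := \sum_(0 <= k < n) killed (surv k) y.
have killed_ge0 k y : 0 <= killed (surv k) y.
  by rewrite /killed; case: ifP => // _; apply: taboo_ge0.
have B_ge0 y : 0 <= B y by apply: sumr_ge0.
have killed_le1 k y : killed (surv k) y <= 1.
  by rewrite /killed; case: ifP => // _; apply: taboo_le1.
have meanB y : y != z -> mean B y = B y - 1 + killed (surv n) y.
  move=> yz; rewrite /B mean_sum.
  have surv_killed k : mean (killed (surv k)) y = killed (surv k.+1) y.
    by rewrite [RHS]/killed (negPf yz).
  under eq_bigr do rewrite surv_killed.
  have : 1 + \sum_(0 <= k < n) killed (surv k.+1) y = B y + killed (surv n) y.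
    rewrite /B -big_nat_recr //= big_nat_recl //; congr (_ + _).
    by rewrite /killed (negPf yz).
  by rewrite /B; lra.
exists (fun y => e^-1 * (U y + M * B y)) => [y|y yz].
  by rewrite mulr_ge0 ?invr_ge0 ?addr_ge0 ?mulr_ge0 // ltW.
rewrite meanZ meanD meanZ meanB //.
rewrite -[X in _ <= _ - X](mulVf (lt0r_neq0 e_gt0)) -mulrBr.
rewrite ler_pM2l ?invr_gt0 //.
case: (boolP (y \in F)) => [yF|/drift].
  by have := leM y yF; lra.
have : 0 <= M * (1 - killed (surv n) y) by rewrite mulr_ge0 // subr_ge0.
lra.
Qed.

End Taboo.
End Means.

(** * Law of the jump chain *)

Section Fibers.
Context d (T : measurableType d) (R : realType) (mu : probability T R).
Variables (V : eqType) (f : T -> V).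
Hypothesis mf : forall v, measurable [set w | f w = v].

Lemma measurable_mem_fiber (s : seq V) : measurable [set w | f w \in s].
Proof.
elim: s => [|a s IHs]; first by rewrite (_ : mkset _ = set0) // -subset0.
rewrite (_ : mkset _ = [set w | f w = a] `|` [set w | f w \in s]).
  exact: measurableU.
apply/seteqP; split => w /=; rewrite inE; first by case/predU1P; [left|right].
by case=> [->|->]; rewrite ?eqxx ?orbT.
Qed.

Lemma measure_mem_fiber (A : set T) (s : seq V) : measurable A -> uniq s ->
  mu (A `&` [set w | f w \in s]) =
  (\sum_(v <- s) mu (A `&` [set w | f w = v]))%E.
Proof.
move=> mA; elim: s => [_|a s IHs /= /andP[/negP nas us]].
  rewrite big_nil (_ : _ `&` _ = set0) ?measure0 // -subset0.
  by move=> w [].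
rewrite big_cons -IHs // -measureU.
- congr (mu _); apply/seteqP; split => [w [Aw]|w] /=; rewrite inE.
    by case/predU1P; [left|right].
  by case=> -[Aw ->]; rewrite ?eqxx ?orbT.
- exact: measurableI.
- by apply: measurableI => //; exact: measurable_mem_fiber.
- by rewrite -subset0 => w [[_ /= wa] [_ /= ws]]; apply: nas; rewrite -wa.
Qed.

(** If the fibers over [s] carry the whole mass of [B], they carry the whole
    mass of each part of [B]. *)
Lemma measure_fibers (A B : set T) (s : seq V) :
  measurable A -> measurable B -> A `<=` B -> uniq s ->
  (\sum_(v <- s) mu (B `&` [set w | f w = v]))%E = mu B ->
  mu A = (\sum_(v <- s) mu (A `&` [set w | f w = v]))%E.
Proof.
move=> mA mB AB us full.
have mS := measurable_mem_fiber s.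
have fin_mu C : measurable C -> mu C \is a fin_num.
  by move=> mC; exact: fin_num_measure.
have B0 : mu (B `\` [set w | f w \in s]) = 0%E.
  rewrite measureD //; last by rewrite -ge0_fin_numE ?fin_mu.
  have E := measure_mem_fiber mB us; rewrite full in E.
  by rewrite [X in (_ - X)%E]E subee ?fin_mu.
rewrite -measure_mem_fiber //.
have -> : mu A = (mu (A `&` [set w | f w \in s])
                  + mu (A `\` [set w | f w \in s]))%E.
  rewrite -measureU ?setUIDK //; [exact: measurableI|exact: measurableD|].
  by rewrite setDE setIACA setICr setI0.
rewrite [X in (_ + X)%E](_ : _ = 0%E) ?adde0 //.
apply/eqP; rewrite eq_le measure_ge0 andbT -B0.
by apply: le_measure; rewrite ?inE; [exact: measurableD..|exact: setSD].
Qed.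

End Fibers.

Section ChainLaw.
Variables (R : realType) (V : countType) (q : V -> V -> R).
Variables (X : minimal_process q) (succ : V -> seq V).
Hypothesis succ_uniq : forall x, uniq (succ x).
Hypothesis sum_jump : forall x, \sum_(y <- succ x) jump_prob q x y = 1.

Local Notation p := (jump_prob q).
Local Notation r := (total_rate q).
Local Notation mean := (mean p succ).
Local Notation taboo := (taboo p succ).

Definition path_prob (y : nat -> V) (k : nat) : R :=
  \prod_(0 <= i < k) p (y i) (y i.+1).

Definition follow_avoid (z : V) (y : nat -> V) (k n : nat) : set (Omega X) :=
  [set w | (forall i, (i <= k)%N -> chain X i w = y i) /\
           (forall i, (k < i <= n)%N -> chain X i w <> z)].

Definition holds_beyond (n : nat) (t : R) : set (Omega X) :=
  [set w | (t%:E < holding X n w)%E].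

Lemma measurable_holds_beyond n t : measurable (holds_beyond n t).
Proof.
rewrite (_ : holds_beyond n t = setT `&` holding X n @^-1` `]t%:E, +oo[).
  by apply: measurable_holding => //; exact: emeasurable_itv.
by rewrite setTI; apply/seteqP; split => w /=; rewrite in_itv /= andbT.
Qed.

Lemma measurable_follow_avoid z y k n : measurable (follow_avoid z y k n).
Proof.
rewrite (_ : follow_avoid z y k n =
  (\bigcap_(i in [set i | (i <= k)%N]) [set w | chain X i w = y i]) `&`
  (\bigcap_(i in [set i | (k < i <= n)%N]) ~` [set w | chain X i w = z])) //.
by apply: measurableI; apply: bigcap_measurableType => // i _;
  [|apply: measurableC]; exact: measurable_chain.
Qed.

Lemma follow_law x z y k (t : R) : 0 <= t ->
  law X x (follow_avoid z y k k `&` holds_beyond k t)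
  = ((y 0%N == x)%:R * path_prob y k * expR (- (r (y k) * t)))%:E.
Proof.
move=> t_ge0; pose u i := if i == k then t else 0.
have u_ge0 i : 0 <= u i by rewrite /u; case: ifP.
transitivity (law X x [set w | forall i, (i <= k)%N ->
  chain X i w = y i /\ ((u i)%:E < holding X i w)%E]).
  congr (law X x _); apply/seteqP; split => [w [[yw _] hw] i ik|w yw].
    rewrite yw // /u; split=> //.
    by case: eqP => [->//|_]; exact: holding_gt0.
  split; last by have [] := yw k (leqnn k); rewrite /u eqxx.
  split=> i; first by move=> ik; case: (yw i ik).
  by case/andP=> ki /(leq_trans ki); rewrite ltnn.
rewrite finite_dim_law // -/(path_prob y k) big_nat_recr //=.
rewrite big_nat big1 ?mul1r /u ?eqxx // => i /andP[_ ik].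
by rewrite ltn_eqF // mulr0 oppr0 expR0.
Qed.

(** The Markov property.  Splitting the event according to the state at time
    [k + 1] lengthens the prefix by one step and shortens the part that avoids
    [z], which is the recursion that defines [taboo]; the exponential weight is
    the tail of the holding time in the last state. *)
Lemma follow_avoid_law x z y k m (t : R) : 0 <= t ->
  law X x (follow_avoid z y k (k + m) `&` holds_beyond (k + m) t)
  = ((y 0%N == x)%:R * path_prob y k *
     taboo z (fun v => expR (- (r v * t))) m (y k))%:E.
Proof.
move=> t_ge0; elim: m k y => [|m IHm] k y; first by rewrite addn0 follow_law.
set A := follow_avoid _ _ _ _ `&` _.
pose B := follow_avoid z y k k `&` holds_beyond k 0.
pose ext v (i : nat) := if i == k.+1 then v else y i.
have path_ext v : path_prob (ext v) k.+1 = path_prob y k * p (y k) v.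
  rewrite /path_prob big_nat_recr //= /ext eqxx ltn_eqF //.
  congr (_ * _); apply: eq_big_nat => i /andP[_ ik].
  by rewrite eqSS (ltn_eqF ik) (ltn_eqF (leqW ik)).
have ext0 v : ext v 0%N = y 0%N by [].
have ext_fiber v :
    follow_avoid z (ext v) k.+1 k.+1 =
    follow_avoid z y k k `&` [set w | chain X k.+1 w = v].
  apply/seteqP; split=> [w [yw _]|w [[yw _] /= wv]].
    split; last by rewrite /= yw // /ext eqxx.
    split=> i; last by case/andP=> ki /(leq_trans ki); rewrite ltnn.
    by move=> ik; rewrite yw ?leqW // /ext ltn_eqF.
  split=> i; last by case/andP=> ki /(leq_trans ki); rewrite ltnn.
  by rewrite /ext leq_eqVlt; case: eqP => [->|_] //= /yw.
have mA : measurable A.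
  apply: measurableI; first exact: measurable_follow_avoid.
  exact: measurable_holds_beyond.
have mB : measurable B.
  apply: measurableI; first exact: measurable_follow_avoid.
  exact: measurable_holds_beyond.
have AB : A `<=` B.
  move=> w [[yw _] _]; split; last exact: holding_gt0.
  by split=> // i /andP[ki] /(leq_trans ki); rewrite ltnn.
have BE v : law X x (B `&` [set w | chain X k.+1 w = v]) =
    ((y 0%N == x)%:R * path_prob y k * p (y k) v)%:E.
  transitivity (law X x (follow_avoid z (ext v) k.+1 k.+1 `&`
                         holds_beyond k.+1 0)).
    congr (law X x _); rewrite ext_fiber; apply/seteqP.
    by split=> w [[? ?] ?]; do ?split => //; exact: holding_gt0.
  by rewrite follow_law // mulr0 oppr0 expR0 mulr1 path_ext mulrA.
(* The successors of [y k] carry the whole mass of the prefix [B], hence that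
   of its part [A]; this avoids a countable sum over all states. *)
have fibersB : (\sum_(v <- succ (y k))
    law X x (B `&` [set w | chain X k.+1 w = v]))%E = law X x B.
  under eq_bigr do rewrite BE.
  rewrite sumEFin -mulr_sumr sum_jump follow_law // mulr0 oppr0 expR0 //.
rewrite (measure_fibers (@measurable_chain _ _ _ X k.+1) mA mB AB _ fibersB) //.
rewrite tabooS mulr_sumr -sumEFin; apply: eq_bigr => v _.
rewrite /killed; case: (eqVneq v z) => [->|vz].
  rewrite !mulr0 (_ : _ `&` _ = set0) ?measure0 // -subset0.
  move=> w [[[_ nz] _] /= wz]; apply: (nz k.+1) => //.
  by rewrite ltnSn addnS ltnS leq_addr.
rewrite mulrA -[_ * path_prob y k * _]mulrA -path_ext -(ext0 v).
rewrite [X in taboo _ _ _ X](_ : v = ext v k.+1); last by rewrite /ext eqxx.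
rewrite -IHm addSn -addnS; congr (law X x _).
apply/seteqP; split=> [w [[[yw nz] hw] /= wv]|w [[yw nz] hw]].
  split=> //; split=> i; last by case/andP=> /ltnW ki ik; apply: nz; rewrite ki.
  rewrite /ext leq_eqVlt; case: eqP => [-> //|_] /= ik; exact: yw.
split; last by rewrite /= yw // /ext eqxx.
split=> //; split=> i.
  by move=> ik; rewrite yw ?leqW // /ext ltn_eqF.
rewrite leq_eqVlt => /andP[/predU1P[<- _|ki ik]]; last by apply: nz; rewrite ki.
by rewrite yw // /ext eqxx; exact/eqP.
Qed.

End ChainLaw.

(** * Jump times, states and return times *)

Section Paths.
Variables (R : realType) (V : countType) (q : V -> V -> R).
Variable X : minimal_process q.

Lemma jump_timeS n w :
  jump_time n.+1 w = (jump_time n w + holding X n w)%E.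
Proof. by rewrite /jump_time big_nat_recr. Qed.

Lemma jump_time_ge0 n (w : Omega X) : (0 <= jump_time n w)%E.
Proof. by apply: sume_ge0 => k _; exact/ltW/holding_gt0. Qed.

Lemma le_jump_time m n (w : Omega X) :
  (m <= n)%N -> (jump_time m w <= jump_time n w)%E.
Proof.
move=> /subnK <-; elim: (n - m)%N => // k IHk; rewrite addSn jump_timeS.
apply: le_trans IHk _; rewrite leeDl //; exact/ltW/holding_gt0.
Qed.

Lemma measurable_jump_time n : measurable_fun setT (@jump_time R V q X n).
Proof. by apply: emeasurable_sum => k; exact: measurable_holding. Qed.

Lemma state_at n t (w : Omega X) :
  (jump_time n w <= t%:E < jump_time n.+1 w)%E ->
  state t w = Some (chain X n w).
Proof.
move=> ntn; rewrite /state; case: pselect => [ex|]; last by case; exists n.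
case: ex_minnP => m /andP[_ tm] /(_ _ ntn); rewrite leq_eqVlt.
case/predU1P=> [->//|/(le_jump_time w) mn]; case/andP: ntn => nt _.
by have := lt_le_trans tm (le_trans mn nt); rewrite ltxx.
Qed.

Lemma state_Some t (w : Omega X) y : state t w = Some y ->
  exists2 n, (jump_time n w <= t%:E < jump_time n.+1 w)%E & chain X n w = y.
Proof.
rewrite /state; case: pselect => [ex|//] [<-].
by case: ex_minnP => m mt _; exists m.
Qed.

Lemma measurable_state t y : measurable [set w : Omega X | state t w = Some y].
Proof.
rewrite (_ : mkset _ = \bigcup_n
  ((@jump_time R V q X n @^-1` `]-oo, t%:E] `&`
    @jump_time R V q X n.+1 @^-1` `]t%:E, +oo[) `&`
   [set w | chain X n w = y])).
  apply: bigcupT_measurable => n; apply: measurableI; last first.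
    exact: measurable_chain.
  by apply: measurableI; rewrite -[X in measurable X]setTI;
    apply: measurable_jump_time => //; exact: emeasurable_itv.
apply/seteqP; split => w /=.
  case/state_Some => n /andP[nt tn] ny; exists n => //.
  by rewrite /= !in_itv /= nt tn.
by case=> n _ /=; rewrite !in_itv /= andbT => -[[nt tn] <-];
  apply: state_at; rewrite nt tn.
Qed.

(** Since each holding time is positive, the chain is in the state it enters at
    every finite jump time. *)
Lemma return_time_le z n (w : Omega X) : (0 < n)%N -> chain X n w = z ->
  (return_time z w <= jump_time n w)%E.
Proof.
move=> n_gt0 nz; case: (ltP (jump_time n w) +oo%E) => [fin|]; last first.
  by rewrite leye_eq => /eqP ->; exact: leey.
have fin_n : jump_time n w \is a fin_num by rewrite ge0_fin_numE ?jump_time_ge0.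
apply: ereal_inf_lbound; exists (fine (jump_time n w)); last by rewrite fineK.
rewrite /= fineK //; split; first exact: le_jump_time.
rewrite (@state_at n) ?nz // fineK // lexx jump_timeS lteDl //.
exact: holding_gt0.
Qed.

Lemma return_time_ge0 z (w : Omega X) : (0 <= return_time z w)%E.
Proof.
apply: le_ereal_inf_tmp => _ [t [t1 _] <-]; apply: le_trans t1.
exact: jump_time_ge0.
Qed.

(** A visit after the first jump is a visit of the chain at a positive index. *)
Lemma return_time_pinfty z (w : Omega X) :
  (forall n, (0 < n)%N -> chain X n w <> z) -> return_time z w = +oo%E.
Proof.
move=> nz; rewrite /return_time (_ : [set _ | _ in _] = set0) ?ereal_inf0 //.
rewrite -subset0 => y [t [t1 /state_Some[n /andP[nt tn] ny]] _].
apply: (nz n) => //; rewrite lt0n; apply/eqP => n0.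
by move: tn; rewrite n0 ltNge t1.
Qed.

End Paths.

Section HoldingSeries.
Variables (R : realType).
Implicit Types (h : \bar R).

Definition exceeds h (j : nat) : \bar R := ((j%:R%:E < h)%E)%:R%:E.

Lemma exceeds_ge0 h j : (0 <= exceeds h j)%E.
Proof. by rewrite lee_fin. Qed.

(** The series counts the unit intervals started before [h], so it is the
    ceiling of [h], or infinite with [h]. *)
Lemma le_exceeds_series h : (0 < h)%E ->
  (h <= \sum_(j <oo) exceeds h j)%E.
Proof.
move=> h_gt0; have ge n : (forall j, (j < n)%N -> (j%:R%:E < h)%E) ->
    (n%:R%:E <= \sum_(j <oo) exceeds h j)%E.
  move=> nh; apply: le_trans _ (nneseries_lim_ge n _) => //; last first.
    by move=> j _ _; exact: exceeds_ge0.
  rewrite big_nat (eq_bigr (fun=> 1%E)); last first.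
    by move=> j /andP[_ /nh jh]; rewrite /exceeds jh.
  by rewrite -big_nat sumEFin sumr_const_nat subn0.
case: (ltP h +oo%E) => [h_fin|]; last first.
  rewrite leye_eq => /eqP hoo; rewrite {1}hoo leye_eq; apply/eqP/eqyP => A _.
  apply: (@le_trans _ _ (Num.truncn A).+1%:R%:E).
    by rewrite lee_fin ltW // truncnS_gt.
  by apply: ge => j _; rewrite hoo ltry.
have [h' hE] : exists h' : R, h = h'%:E.
  by exists (fine h); rewrite fineK // ge0_fin_numE // ltW.
have exn : exists n, (h <= n%:R%:E)%E.
  by exists (Num.truncn h').+1; rewrite hE lee_fin ltW // truncnS_gt.
case: (ex_minnP exn) => n hn n_min; apply: le_trans hn (ge n _) => j jn.
by rewrite ltNge; apply: contraL jn => /n_min; rewrite -leqNgt.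
Qed.
End HoldingSeries.

(** * Positive recurrence from a drift condition *)

Section Recurrence.
Variables (R : realType) (V : countType) (q : V -> V -> R).
Variables (X : minimal_process q) (succ : V -> seq V).
Hypothesis jump_ge0 : forall x y, 0 <= jump_prob q x y.
Hypothesis succ_uniq : forall x, uniq (succ x).
Hypothesis sum_jump : forall x, \sum_(y <- succ x) jump_prob q x y = 1.

Local Notation p := (jump_prob q).
Local Notation r := (total_rate q).
Local Notation mean := (mean p succ).
Local Notation taboo := (taboo p succ).

Definition not_back (z : V) (k j : nat) : set (Omega X) :=
  [set w | forall i, (0 < i <= k)%N -> chain X i w <> z] `&`
  @holds_beyond _ _ _ X k j%:R.

Lemma measurable_not_back z k j : measurable (not_back z k j).
Proof.
apply: measurableI; last exact: measurable_holds_beyond.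
rewrite (_ : mkset _ = \bigcap_(i in [set i | (0 < i <= k)%N])
  ~` [set w | chain X i w = z]) //.
by apply: bigcap_measurableType => // i _; apply: measurableC;
  exact: measurable_chain.
Qed.

Lemma law_start z (A : set (Omega X)) : measurable A ->
  law X z A = law X z (A `&` [set w | chain X 0 w = z]).
Proof.
move=> mA.
rewrite (@measure_fibers _ _ _ (law X z) _ (chain X 0) _ A setT [:: z]) //.
- by rewrite big_seq1.
- exact: measurable_chain.
rewrite big_seq1 setTI probability_setT.
have <- : [set w | forall k, (k <= 0)%N -> chain X k w = z /\
    (0%:E < holding X k w)%E] = [set w | chain X 0 w = z].
  apply/seteqP; split=> [w /(_ 0%N (leqnn 0))[]//|w wz k].
  by rewrite leqn0 => /eqP ->; split=> //; exact: holding_gt0.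
rewrite (@finite_dim_law _ _ _ X z 0 (fun=> z) (fun=> 0)) //.
by rewrite big_geq // big_nat1 eqxx mulr0 oppr0 expR0 !mul1r.
Qed.

Lemma not_back_law z k j :
  law X z (not_back z k j) =
  (taboo z (fun v => expR (- (r v * j%:R))) k z)%:E.
Proof.
rewrite law_start; last exact: measurable_not_back.
have := follow_avoid_law X succ_uniq sum_jump z z (fun=> z) 0 k (ler0n R j).
rewrite /path_prob big_geq // eqxx !mul1r add0n => <-; congr (law X z _).
apply/seteqP; split=> [w [[nz hw] wz]|w [[wz nz] hw]].
  by split=> //; split=> // i; rewrite leqn0 => /eqP ->.
by split=> //; exact: wz.
Qed.

(** Up to the first return, each holding time is at most its number of started
    unit intervals; without a return, or with an infinite holding time, the
    double series diverges. *)
Lemma return_time_le_series z w :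
  (return_time z w <=
   \sum_(k <oo) \sum_(j <oo) (\1_(not_back z k j) w)%:E)%E.
Proof.
set S := (leRHS).
have ge n : (forall i, (0 < i < n)%N -> chain X i w <> z) ->
    (\sum_(0 <= k < n) holding X k w <= S)%E.
  move=> nz; apply: le_trans _ (nneseries_lim_ge n _); last first.
    by move=> k _ _; apply: nneseries_ge0 => j _ _; rewrite lee_fin.
  rewrite big_nat [leRHS]big_nat; apply: lee_sum => k /andP[_ kn].
  apply: le_trans (le_exceeds_series (holding_gt0 k w)) _.
  apply: lee_nneseries => [j _ _|j _]; first exact: exceeds_ge0.
  rewrite /exceeds lee_fin indicE ler_nat; case: (ltP j%:R%:E) => // jh.
  rewrite mem_set //; split=> // i /andP[i_gt0 ik].
  by apply: nz; rewrite i_gt0 (leq_ltn_trans ik kn).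
have [ret|never] := pselect (exists n, (0 < n)%N && (chain X n w == z)).
  case: (ex_minnP ret) => m /andP[m_gt0 /eqP mz] m_min.
  apply: le_trans (return_time_le m_gt0 mz) _; apply: ge => i /andP[i_gt0 im].
  by move=> iz; move: im; rewrite ltnNge m_min // i_gt0 iz eqxx.
rewrite [S](_ : _ = +oo%E) ?leey //; apply/eqyP => A A_gt0.
apply: le_trans _ (nneseries_lim_ge (Num.truncn A).+1 _); last first.
  by move=> k _ _; apply: nneseries_ge0 => j _ _; rewrite lee_fin.
apply: (@le_trans _ _ (\sum_(0 <= k < (Num.truncn A).+1) 1%:E)%E).
  by rewrite sumEFin sumr_const_nat subn0 lee_fin ltW // truncnS_gt.
apply: lee_sum => k _; apply: le_trans _ (nneseries_lim_ge 1 _); last first.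
  by move=> j _ _; rewrite lee_fin.
rewrite big_nat1 indicE mem_set //; split; last exact: holding_gt0.
move=> i /andP[i_gt0 _] iz; apply: never; exists i.
by rewrite i_gt0 iz eqxx.
Qed.

(** Holding times have rate at least [rmin], so each visited state costs at most
    [1 / (1 - exp (- rmin))] started unit intervals on average, and the number
    of visited states has finite mean by [sum_taboo_le]. *)
Lemma foster_positive_recurrent (rmin : R) (z : V) (U : V -> R) :
  0 < rmin -> (forall x, rmin <= r x) -> (forall y, 0 <= U y) ->
  (forall y, y != z -> mean U y <= U y - 1) ->
  (\int[law X z]_w return_time z w < +oo)%E.
Proof.
move=> rmin_gt0 rminP U_ge0 drift; pose a := expR (- rmin).
have a_gt0 : 0 < a := expR_gt0 _.
have a_lt1 : a < 1 by rewrite expR_lt1 oppr_lt0.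
pose c k := taboo z (fun=> 1) k z.
have c_ge0 k : 0 <= c k by apply: (taboo_ge0 jump_ge0).
have d_gt0 : 0 < (1 - a)^-1 by rewrite invr_gt0 subr_gt0.
apply: (@le_lt_trans _ _ ((1 - a)^-1 * (1 + mean U z))%:E); last exact: ltry.
apply: le_trans (ge0_integral_mono _ (@return_time_ge0 _ _ _ X z)
  (return_time_le_series z)) _.
have m1 k j : measurable_fun setT
    (fun w => (\1_(not_back z k j) w : R)%:E).
  by apply/measurable_EFinP/measurable_indic/measurable_not_back.
rewrite integral_nneseries //; last 2 first.
- by move=> k; apply: ge0_emeasurable_sum => // j w _ _; rewrite lee_fin.
- by move=> k w _; apply: nneseries_ge0 => j _ _; rewrite lee_fin.
apply: nneseries_le_bound => [k|n].
  by apply: integral_ge0 => w _; apply: nneseries_ge0 => j _ _; rewrite lee_fin.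
apply: (@le_trans _ _ (\sum_(0 <= k < n) ((1 - a)^-1 * c k)%:E)%E); last first.
  rewrite sumEFin lee_fin -mulr_sumr ler_pM2l //.
  exact: sum_taboo_le.
apply: lee_sum => k _; rewrite integral_nneseries //.
apply: nneseries_le_bound => [j|m].
  by apply: integral_ge0 => w _; rewrite lee_fin.
apply: (@le_trans _ _ (\sum_(0 <= j < m) (a ^+ j * c k)%:E)%E).
  apply: lee_sum => j _; rewrite integral_indic //; last first.
    exact: measurable_not_back.
  rewrite setIT [leLHS]not_back_law lee_fin /c. apply: taboo_leZ => // v.
  rewrite mulr1 /a -expRM_natr ler_expR mulNr lerN2.
  by rewrite ler_wpM2r.
rewrite sumEFin lee_fin -mulr_suml ler_wpM2r //.
have := geometric_le_lim m ler01 a_gt0.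
rewrite gtr0_norm // mul1r => /(_ a_lt1).
by rewrite /series /= /geometric; under eq_bigr do rewrite mul1r.
Qed.

End Recurrence.

(** * Reaching a state at a fixed time *)

Section Reachability.
Variables (R : realType) (V : countType) (q : V -> V -> R).
Variable X : minimal_process q.
Local Notation p := (jump_prob q).
Local Notation r := (total_rate q).

Definition follow_long (y : nat -> V) (n : nat) (u : nat -> R) :
    set (Omega X) :=
  [set w | forall k, (k <= n)%N ->
     chain X k w = y k /\ ((u k)%:E < holding X k w)%E].

Lemma measurable_follow_long y n u : measurable (follow_long y n u).
Proof.
rewrite (_ : follow_long y n u = \bigcap_(k in [set k | (k <= n)%N])
  ([set w | chain X k w = y k] `&` @holds_beyond _ _ _ X k (u k))) //.
apply: bigcap_measurableType => // k _; apply: measurableI.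
  exact: measurable_chain.
exact: measurable_holds_beyond.
Qed.

(** With [n] holding times of at most [T = n / rmin] each followed by one beyond
    [n T], the process sits at the end of the path at time [n T].  Requiring a
    given one of the [n] to exceed [T] multiplies the probability by at most
    [exp (- n)], and [n exp (- n) < 1], so these [n] bad events leave some
    mass. *)
Lemma reach_state (rmin : R) (y : nat -> V) (n : nat) : 0 < rmin ->
  (forall x, rmin <= r x) -> (forall k, (k < n)%N -> 0 < p (y k) (y k.+1)) ->
  exists t : R,
    0 <= t /\ (0 < law X (y 0%N) [set w | state t w = Some (y n)])%E.
Proof.
move=> rmin_gt0 rminP p_gt0; pose T := n%:R / rmin.
have T_ge0 : 0 <= T by rewrite divr_ge0 // ltW.
have nT_ge0 : 0 <= n%:R * T by rewrite mulr_ge0.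
exists (n%:R * T); split=> //; set S := mkset _.
pose u k := if k == n then n%:R * T else 0.
pose u' i k := if k == i then T else u k.
have u_ge0 k : 0 <= u k by rewrite /u; case: ifP.
have u'_ge0 i k : 0 <= u' i k by rewrite /u'; case: ifP.
pose beta := path_prob q y n * expR (- (r (y n) * (n%:R * T))).
have beta_gt0 : 0 < beta.
  rewrite mulr_gt0 ?expR_gt0 // /path_prob big_nat; apply: prodr_gt0 => k.
  by case/andP=> _ /p_gt0.
have lawD : law X (y 0%N) (follow_long y n u) = beta%:E.
  rewrite finite_dim_law // eqxx mul1r.
  rewrite [X in _ * X](_ : _ = expR (- (r (y n) * (n%:R * T)))) //.
  rewrite big_nat_recr //= big_nat big1 => [|k /andP[_ kn]].
    by rewrite mul1r /u eqxx.
  by rewrite /u ltn_eqF // mulr0 oppr0 expR0.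
have lawD' i : (i < n)%N ->
    law X (y 0%N) (follow_long y n (u' i)) = (beta * expR (- (r (y i) * T)))%:E.
  move=> i_n; rewrite finite_dim_law // eqxx mul1r -mulrA.
  rewrite [X in _ * X](_ : _ = expR (- (r (y n) * (n%:R * T))) *
                               expR (- (r (y i) * T))) //.
  rewrite big_nat_recr //= (bigD1_seq i) ?iota_uniq ?mem_index_iota //=.
  rewrite big_nat_cond big1 => [|k /andP[/andP[_ kn] /negPf ki]].
    by rewrite mulr1 /u' /u !eqxx gtn_eqF // mulrC.
  by rewrite /u' /u ki ltn_eqF // mulr0 oppr0 expR0.
have mS : measurable S by exact: measurable_state.
pose Bad := \big[setU/set0]_(i < n) follow_long y n (u' i).
have mBad : measurable Bad.
  by apply: bigsetU_measurable => i _; exact: measurable_follow_long.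
have cover : follow_long y n u `<=` S `|` Bad.
  move=> w uw; have [wBad|nBad] := pselect (Bad w); first by right.
  left; have [wn hn] := uw n (leqnn n); rewrite /S /= -wn; apply: state_at.
  have short k : (k < n)%N -> (holding X k w <= T%:E)%E.
    move=> kn; rewrite leNgt; apply/negP => Tk; apply: nBad.
    rewrite /Bad -(bigcup_mkord n (fun i => follow_long y n (u' i))).
    exists k => // i ik; split.
      by have [] := uw i ik.
    by rewrite /u'; case: eqP => [->//|_]; have [] := uw i ik.
  apply/andP; split.
    rewrite /jump_time big_nat.
    apply: (@le_trans _ _ (\sum_(0 <= k < n) T%:E)%E).
      by rewrite [leRHS]big_nat; apply: lee_sum => k /andP[_ /short].
    by rewrite sumEFin sumr_const_nat subn0 lee_fin mulr_natl.
  rewrite jump_timeS; apply: lt_le_trans (_ : holding X n w <= _)%E.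
    by move: hn; rewrite /u eqxx.
  by rewrite leeDr // jump_time_ge0.
have leBad : (law X (y 0%N) Bad <= (n%:R * (beta * expR (- n%:R)))%:E)%E.
  apply: le_trans (@Boole_inequality _ _ _ (law X (y 0%N))
    (fun i => follow_long y n (u' i)) n
    (fun i _ => measurable_follow_long _ _ _)) _.
  apply: (@le_trans _ _ (\sum_(i < n) (beta * expR (- n%:R))%:E)%E).
    apply: lee_sum => i _; rewrite [leLHS]lawD' // lee_fin ler_pM2l //.
    rewrite ler_expR lerN2 /T mulrA ler_pdivlMr // mulrC.
    by rewrite ler_wpM2r.
  by rewrite sumEFin sumr_const card_ord lee_fin mulr_natl.
rewrite lt0e measure_ge0 andbT; apply/eqP => S0.
have : (beta%:E <= (n%:R * (beta * expR (- n%:R)))%:E)%E.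
  rewrite -lawD; apply: le_trans (le_measure _ _ _ cover) _; rewrite ?inE.
  - exact: measurable_follow_long.
  - exact: measurableU.
  - apply: le_trans (measureU2 _ mS mBad) _.
    by rewrite [X in (X + _)%E]S0 add0e.
rewrite lee_fin mulrCA -[leLHS]mulr1 ler_pM2l // leNgt => /negP; apply.
rewrite expRN ltr_pdivrMr ?expR_gt0 // mul1r.
by apply: lt_le_trans (expR_ge1Dx _); rewrite ltrDr.
Qed.

End Reachability.

(** * Infinite return times from a superharmonic function *)

Section Transience.
Variables (R : realType) (V : countType) (q : V -> V -> R).
Variables (X : minimal_process q) (succ : V -> seq V).
Hypothesis jump_ge0 : forall x y, 0 <= jump_prob q x y.
Hypothesis succ_uniq : forall x, uniq (succ x).
Hypothesis sum_jump : forall x, \sum_(y <- succ x) jump_prob q x y = 1.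

Local Notation p := (jump_prob q).
Local Notation r := (total_rate q).
Local Notation mean := (mean p succ).

(** The capped function [min (W / m) 1] is superharmonic everywhere, equals 1 at
    [z], and is below 1 at the end of the path: from there the chain avoids [z]
    forever with positive probability. *)
Lemma superharmonic_not_positive_recurrent (z : V) (F : set V) (W : V -> R)
    (m : R) (y : nat -> V) (k : nat) :
  0 < m -> (forall x, 0 <= W x) -> (forall x, ~ F x -> mean W x <= W x) ->
  (forall x, F x -> m <= W x) -> F z ->
  y 0%N = z -> (forall i, (0 < i <= k)%N -> y i != z) ->
  (forall i, (i < k)%N -> 0 < p (y i) (y i.+1)) -> W (y k) < m ->
  (\int[law X z]_w return_time z w = +oo)%E.
Proof.
move=> m_gt0 W_ge0 supW WF Fz y0 yz p_gt0 Wyk.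
pose h x := Num.min (W x / m) 1.
have h01 x : 0 <= h x <= 1.
  by rewrite ge_min lexx orbT le_min ler01 divr_ge0 // ltW.
have hF x : F x -> h x = 1.
  by move=> /WF mW; apply/min_idPr; rewrite ler_pdivlMr // mul1r.
have suph x : mean h x <= h x.
  have le1 : mean h x <= 1.
    rewrite -[leRHS](mean_cst sum_jump 1 x); apply: le_mean => // v.
    by case/andP: (h01 v).
  have [/hF -> //|/supW Wx] := pselect (F x).
  rewrite le_min le1 andbT.
  apply: (@le_trans _ _ (mean (fun v => m^-1 * W v) x)).
    by apply: le_mean => // v; rewrite ge_min mulrC lexx.
  by rewrite meanZ mulrC ler_pM2r // invr_gt0.
pose E n :=
  @follow_avoid _ _ _ X z y k (k + n) `&` @holds_beyond _ _ _ X (k + n) 0.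
have mE n : measurable (E n).
  apply: measurableI; first exact: measurable_follow_avoid.
  exact: measurable_holds_beyond.
pose c := path_prob q y k * (1 - h (y k)).
have c_gt0 : 0 < c.
  rewrite mulr_gt0 //; last first.
    by rewrite subr_gt0 /h gt_min ltr_pdivrMr // mul1r Wyk.
  by rewrite /path_prob big_nat; apply: prodr_gt0 => i /andP[_ /p_gt0].
have lawE n : (c%:E <= law X z (E n))%E.
  rewrite [leRHS](follow_avoid_law X succ_uniq sum_jump) //.
  rewrite y0 eqxx mul1r lee_fin.
  rewrite ler_wpM2l //; last first.
    apply: le_trans (taboo_superharmonic jump_ge0 sum_jump n (y k)
      (hF z Fz) h01 suph) _.
    rewrite -[leRHS]mul1r; apply: taboo_leZ => // v.
    by rewrite mulr0 oppr0 expR0 mulr1.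
  by rewrite /path_prob; apply: prodr_ge0.
have mcapE : measurable (\bigcap_n E n) by exact: bigcapT_measurable.
have decE : nonincreasing_seq E.
  apply/nonincreasing_seqP => n; rewrite subsetEset => w [[yw nz] _].
  split; last exact: holding_gt0.
  by split=> // i /andP[ki ik]; apply: nz; rewrite ki addnS leqW.
have lawcap : (c%:E <= law X z (\bigcap_n E n))%E.
  have cvgE : law X z \o E @ \oo --> law X z (\bigcap_n E n).
    apply: nonincreasing_cvg_mu => //.
    exact: le_lt_trans (probability_le1 _ (mE 0%N)) (ltry 1).
  rewrite -(cvg_lim _ cvgE) //; apply: lime_ge; first exact: cvgP cvgE.
  exact: nearW.
apply/eqP; rewrite -leye_eq.
apply: (@le_trans _ _ (\int[law X z]_(w in \bigcap_n E n) cst +oo%E w)%E).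
  by rewrite integral_cst // gt0_mulye // (lt_le_trans _ lawcap) // lte_fin.
rewrite integral_mkcond; apply: ge0_integral_mono => w.
  by apply: erestrict_ge0 => v _; exact: leey.
rewrite /patch; case: ifPn => [/set_mem capE|_]; last exact: return_time_ge0.
rewrite return_time_pinfty // => n n_gt0.
have [[yw nz] _] := capE n I.
case: (leqP n k) => [nk|kn]; first by rewrite yw //; apply/eqP/yz; rewrite n_gt0.
by apply: nz; rewrite kn leq_addl.
Qed.

End Transience.

(** * Rates with finitely many successors *)

Section LocallyFinite.
Variables (R : realType) (V : countType) (q : V -> V -> R).
Variable succ : V -> seq V.
Hypothesis q_ge0 : forall x y, 0 <= q x y.
Hypothesis succ_uniq : forall x, uniq (succ x).
Hypothesis succ_irr : forall x, x \notin succ x.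
Hypothesis q_succ : forall x y, y \notin succ x -> q x y = 0.
Hypothesis rate_gt0 : forall x, 0 < total_rate q x.

Lemma total_rateE x : total_rate q x = \sum_(y <- succ x) q x y.
Proof.
rewrite /total_rate esum_mkcond.
rewrite (_ : \esum_(y in _) _ = \esum_(y in [set` succ x]) (q x y)%:E).
  rewrite esum_fset //; last 2 first.
  - exact: finite_seq.
  - by move=> y _; rewrite lee_fin.
  by rewrite -fsbig_seq // sumEFin.
rewrite [RHS]esum_mkcond; apply: eq_esum => y _.
case: (boolP (y \in succ x)) => [ys|ys].
  rewrite mem_set; last by move=> yx; move: (succ_irr x); rewrite -{1}yx ys.
  by rewrite mem_set.
by rewrite q_succ // !if_same.
Qed.

Lemma jump_probE x y : y \in succ x ->
  jump_prob q x y = q x y / total_rate q x.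
Proof.
move=> ys; rewrite /jump_prob gt_eqF //; case: eqP => // xy.
by move: (succ_irr x); rewrite {1}xy ys.
Qed.

Lemma jump_prob_ge0 x y : 0 <= jump_prob q x y.
Proof.
by rewrite /jump_prob gt_eqF //; case: ifP => // _; rewrite divr_ge0 // ltW.
Qed.

Lemma sum_jump_prob x : \sum_(y <- succ x) jump_prob q x y = 1.
Proof.
rewrite big_seq; under eq_bigr do rewrite jump_probE //.
by rewrite -big_seq -mulr_suml -total_rateE divff // gt_eqF.
Qed.

Lemma total_rate_mean (f : V -> R) x :
  total_rate q x * mean (jump_prob q) succ f x = \sum_(y <- succ x) q x y * f y.
Proof.
rewrite /mean mulr_sumr big_seq [RHS]big_seq; apply: eq_bigr => y ys.
by rewrite jump_probE // mulrA (mulrC (total_rate q x)) divfK // gt_eqF.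
Qed.

(** The total rate is the mean number of jumps per unit of time. *)
Lemma mean_drift (f : V -> R) e x :
  \sum_(y <- succ x) q x y * (f y - f x) <= - e * total_rate q x ->
  mean (jump_prob q) succ f x <= f x - e.
Proof.
under eq_bigr do rewrite mulrBr.
rewrite sumrB -mulr_suml -total_rateE -total_rate_mean => drift.
by rewrite -(ler_pM2l (rate_gt0 x)); lra.
Qed.

End LocallyFinite.

Section LocallyFiniteErgodicity.
Variables (R : realType) (V : countType) (q : V -> V -> R).
Variables (X : minimal_process q) (succ : V -> seq V) (rmin : R).
Hypothesis q_ge0 : forall x y, 0 <= q x y.
Hypothesis succ_uniq : forall x, uniq (succ x).
Hypothesis succ_irr : forall x, x \notin succ x.
Hypothesis q_succ : forall x y, y \notin succ x -> q x y = 0.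
Hypothesis rmin_gt0 : 0 < rmin.
Hypothesis rminP : forall x, rmin <= total_rate q x.

Let rate_gt0 x : 0 < total_rate q x := lt_le_trans rmin_gt0 (rminP x).

Definition reachable (x y : V) : Prop :=
  exists2 s, path (step (jump_prob q) succ) x s & last x s = y.

Lemma reachable_step x y : y \in succ x -> 0 < q x y -> reachable x y.
Proof.
move=> ys q_gt0; exists [:: y] => //=.
rewrite andbT /step ys (jump_probE succ_irr rate_gt0) //.
exact: divr_gt0.
Qed.

Lemma reachable_trans x y z : reachable x y -> reachable y z -> reachable x z.
Proof.
move=> [s xs sy] [t yt tz]; exists (s ++ t); first by rewrite cat_path xs sy.
by rewrite last_cat sy.
Qed.

Hypothesis connected : forall x y, reachable x y.

Lemma connected_irreducible : irreducible X.
Proof.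
move=> x z; have [s ps ls] := connected x z.
have [|t [t_ge0 pos]] := @reach_state _ _ _ X _ (nth x (x :: s)) (size s)
  rmin_gt0 rminP.
  by move=> k ks; have /(pathP x) /(_ k ks) /andP[] := ps.
exists t; split=> //; move: pos.
by rewrite -[size s]/(size (x :: s)).-1 nth_last /= ls.
Qed.

Theorem foster_ergodic (U : V -> R) (F : seq V) (e : R) :
  0 < e -> (forall x, 0 <= U x) ->
  (forall x, x \notin F -> \sum_(y <- succ x) q x y * (U y - U x)
                           <= - e * total_rate q x) ->
  ergodic X.
Proof.
move=> e_gt0 U_ge0 drift; split=> [|z]; first exact: connected_irreducible.
have p_ge0 := jump_prob_ge0 q_ge0 rate_gt0.
have sum_p := sum_jump_prob q_ge0 succ_uniq succ_irr q_succ rate_gt0.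
have [||W W_ge0 driftW] := @foster_single_state _ _ _ _ p_ge0 sum_p z U F e
  e_gt0 U_ge0.
- by move=> x /drift /(mean_drift q_ge0 succ_uniq succ_irr q_succ rate_gt0).
- by move=> x _; apply: connected.
right; exact: (foster_positive_recurrent X p_ge0 succ_uniq sum_p rmin_gt0 rminP
  W_ge0 driftW).
Qed.

End LocallyFiniteErgodicity.

(** * The tandem rates *)

Section Tandem.
Variables (R : realType) (lambda : nat -> R) (mu1 mu2 : R).
Local Notation q := (tandem_rate lambda mu1 mu2).
Local Notation r := (total_rate q).

(** The arrival is listed also where [lambda] vanishes. *)
Definition tandem_succ (x : nat * nat) : seq (nat * nat) :=
  (x.1.+1, x.2) :: (if (0 < x.1)%N then [:: (x.1.-1, x.2.+1)] else [::])
                ++ (if (0 < x.2)%N then [:: (x.1, x.2.-1)] else [::]).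

Lemma tandem_succ_uniq x : uniq (tandem_succ x).
Proof.
by case: x => [[|a] [|b]]; rewrite /tandem_succ /= ?inE ?xpair_eqE; lia.
Qed.

Lemma tandem_succ_irr x : x \notin tandem_succ x.
Proof.
by case: x => [[|a] [|b]]; rewrite /tandem_succ /= ?inE ?xpair_eqE; lia.
Qed.

Lemma tandem_rate_succ x y : y \notin tandem_succ x -> q x y = 0.
Proof.
rewrite /tandem_succ /tandem_rate inE mem_cat negb_or => /andP[/negPf ->].
by case: (0 < x.1)%N; case: (0 < x.2)%N; rewrite ?inE ?orbF ?negb_or //=;
  first case/andP; move=> /negPf -> // /negPf ->.
Qed.

Lemma sum_tandem (f : nat * nat -> R) x :
  \sum_(y <- tandem_succ x) q x y * f y =
  lambda x.2 * f (x.1.+1, x.2)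
  + (if (0 < x.1)%N then mu1 * f (x.1.-1, x.2.+1) else 0)
  + (if (0 < x.2)%N then mu2 * f (x.1, x.2.-1) else 0).
Proof.
have neq (u v : nat * nat) : (u.1 != v.1) || (u.2 != v.2) -> (u == v) = false.
  by rewrite -negb_and -xpair_eqE -!surjective_pairing => /negPf.
case: x => [a b]; rewrite /tandem_succ big_cons big_cat /= addrA.
rewrite {1}/tandem_rate eqxx /=; congr (_ + _ + _).
  case: ifP => a_gt0; rewrite ?big_nil // big_seq1 /tandem_rate /= a_gt0 eqxx.
  by rewrite neq //=; lia.
case: ifP => b_gt0; rewrite ?big_nil // big_seq1 /tandem_rate /= b_gt0 eqxx.
rewrite neq /=; last lia.
by rewrite neq ?andbF //=; lia.
Qed.

Hypothesis lambda_ge0 : forall n, 0 <= lambda n.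
Hypothesis lambda0_gt0 : 0 < lambda 0%N.
Hypothesis mu1_gt0 : 0 < mu1.
Hypothesis mu2_gt0 : 0 < mu2.

Lemma tandem_rate_ge0 x y : 0 <= q x y.
Proof. by rewrite /tandem_rate; do ![case: ifP => _ //]; exact: ltW. Qed.

Lemma tandem_total_rate x :
  r x = lambda x.2 + (if (0 < x.1)%N then mu1 else 0)
                   + (if (0 < x.2)%N then mu2 else 0).
Proof.
rewrite (total_rateE tandem_rate_ge0 tandem_succ_uniq tandem_succ_irr
  tandem_rate_succ).
under eq_bigr do rewrite -[q _ _]mulr1.
by rewrite (sum_tandem (fun=> 1)) !mulr1.
Qed.

Definition tandem_rmin : R := Num.min (lambda 0%N) (Num.min mu1 mu2).

Lemma tandem_rmin_gt0 : 0 < tandem_rmin.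
Proof. by rewrite !lt_min lambda0_gt0 mu1_gt0. Qed.

Lemma tandem_rminP x : tandem_rmin <= r x.
Proof.
rewrite tandem_total_rate /tandem_rmin; case: x => [[|a] [|b]] /=.
- by rewrite !addr0 ge_min lexx.
- by rewrite addr0 !ge_min (ler_wpDl (lambda_ge0 _) (lexx mu2)) !orbT.
- by rewrite addr0 !ge_min (ler_wpDl (lambda_ge0 _) (lexx mu1)) !orbT.
- by rewrite !ge_min (ler_wpDl _ (lexx mu2)) ?orbT // addr_ge0 // ltW.
Qed.

Let reach_step x y :=
  reachable_step tandem_succ_irr tandem_rmin_gt0 tandem_rminP (x := x) (y := y).

(** A system can be served until it is empty; an empty one can be filled at the
    first queue, and customers then moved to the second. *)
Lemma tandem_connected x y : reachable q tandem_succ x y.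
Proof.
have arrive a : reachable q tandem_succ (a, 0%N) (a.+1, 0%N).
  by apply: reach_step; rewrite ?inE ?eqxx // /tandem_rate eqxx.
have move_on a b : reachable q tandem_succ (a.+1, b) (a, b.+1).
  apply: reach_step; first by rewrite /tandem_succ /= !inE eqxx orbT.
  rewrite /tandem_rate /= eqxx xpair_eqE.
  by rewrite [X in X && _](_ : _ = false) //; lia.
have leave a b : reachable q tandem_succ (a, b.+1) (a, b).
  apply: reach_step.
    by rewrite /tandem_succ /= inE mem_cat inE eqxx !orbT.
  rewrite /tandem_rate /= eqxx !xpair_eqE.
  rewrite [X in if X then _ else _](_ : _ = false); last lia.
  by rewrite [X in if X then _ else _](_ : _ = false) //; lia.
have empty2 a b : reachable q tandem_succ (a, b) (a, 0%N).
  by elim: b => [|b]; [exists [::]|apply: reachable_trans (leave a b)].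
have empty a : reachable q tandem_succ (a, 0%N) (0%N, 0%N).
  elim: a => [|a IHa]; first by exists [::].
  exact: reachable_trans (move_on a 0%N) (reachable_trans (leave a 0%N) IHa).
have fill a : reachable q tandem_succ (0%N, 0%N) (a, 0%N).
  elim: a => [|a IHa]; first by exists [::].
  exact: reachable_trans IHa (arrive a).
have spread a b : reachable q tandem_succ ((a + b)%N, 0%N) (a, b).
  elim: b a => [|b IHb] a; first by rewrite addn0; exists [::].
  by rewrite addnS -addSn; exact: reachable_trans (IHb a.+1) (move_on a b).
case: x y => [a b] [c d]; apply: reachable_trans (empty2 a b) _.
apply: reachable_trans (empty a) _.
exact: reachable_trans (fill (c + d)%N) (spread c d).
Qed.

End Tandem.

(** * Stability below the threshold *)

Section PoissonIncrements.
Variables (R : realType) (mu1 mu2 : R).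
Hypothesis mu1_gt0 : 0 < mu1.
Hypothesis mu2_gt0 : 0 < mu2.

(** Increments of a solution [g] of the Poisson equation
    [mu1 (g (n + 1) - g n) + mu2 (g (n - 1) - g n) = f n]
    of the saturated second queue, with no service term at [n = 0]. *)
Fixpoint poisson (f : nat -> R) (n : nat) : R :=
  if n is m.+1 then (mu2 * poisson f m + f n) / mu1 else f 0%N / mu1.

Lemma poisson0 f : mu1 * poisson f 0 = f 0%N.
Proof. by rewrite /= mulrC divfK // gt_eqF. Qed.

Lemma poissonS f n : mu1 * poisson f n.+1 = mu2 * poisson f n + f n.+1.
Proof. by rewrite /= mulrC divfK // gt_eqF. Qed.

(** The geometric weights [rho^n] satisfy [mu2 rho^(n + 1) = mu1 rho^n], so the
    weighted equations telescope. *)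
Lemma poisson_sum f n :
  mu1 * (mu1 / mu2) ^+ n * poisson f n =
  \sum_(0 <= k < n.+1) (mu1 / mu2) ^+ k * f k.
Proof.
have mu2_neq0 : mu2 != 0 by rewrite gt_eqF.
elim: n => [|n IHn]; first by rewrite big_nat1 !expr0 mulr1 mul1r poisson0.
rewrite big_nat_recr //= -IHn -[_ / mu1]/(poisson f n.+1).
rewrite mulrAC poissonS mulrC mulrDr; congr (_ + _).
by rewrite exprS; field.
Qed.

End PoissonIncrements.

Section Stability.
Variables (R : realType) (lambda : nat -> R) (mu1 mu2 c : R).
Hypothesis lambda_ge0 : forall n, 0 <= lambda n.
Hypothesis lambda0_gt0 : 0 < lambda 0%N.
Hypothesis mu1_gt0 : 0 < mu1.
Hypothesis mu1_lt_mu2 : mu1 < mu2.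
Hypothesis c_lt_mu1 : c < mu1.
Hypothesis mean_le_c : forall n,
  \sum_(0 <= k < n) lambda k * ((1 - mu1 / mu2) * (mu1 / mu2) ^+ k) <= c.

Local Notation rho := (mu1 / mu2).

Let mu2_gt0 : 0 < mu2 := lt_trans mu1_gt0 mu1_lt_mu2.
Let mu2_neq0 : mu2 != 0 := lt0r_neq0 mu2_gt0.
Let rho_gt0 : 0 < rho := divr_gt0 mu1_gt0 mu2_gt0.
Let rho_lt1 : rho < 1. Proof. by rewrite ltr_pdivrMr // mul1r. Qed.

Section Inflation.
Variables (e : R) (N : nat).

(** The arrival rates are raised in two ways that cost little in mean: by a
    factor [1 + e], which turns a drift into one proportional to the total rate,
    and by [mu2] from [N] on, which controls the boundary [x1 = 0]. *)
Definition inflated (n : nat) : R :=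
  (1 + e) * lambda n + (if (N <= n)%N then mu2 else 0).

Definition inflated_mean : R := (1 + e) * c + mu2 * rho ^+ N.

Local Notation incr := (poisson mu1 mu2 (fun n => inflated_mean - inflated n)).

Lemma inflated_sum n :
  (1 - rho) * (\sum_(0 <= k < n) rho ^+ k * (inflated_mean - inflated k)) =
  inflated_mean * (1 - rho ^+ n)
  - (1 + e) * \sum_(0 <= k < n) lambda k * ((1 - rho) * rho ^+ k)
  - mu2 * (if (N <= n)%N then rho ^+ N - rho ^+ n else 0).
Proof.
elim: n => [|n IHn].
  rewrite !big_nil expr0 subrr !mulr0 subr0.
  by case: N => [|N']; rewrite ?expr0 ?subrr ?if_same mulr0 subr0.
rewrite !big_nat_recr //= mulrDr IHn /inflated exprS.
case: (ltngtP N n.+1) => [|nN|->].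
- rewrite ltnS => Nn; rewrite Nn; ring.
- by rewrite leqNgt (ltn_trans (ltnSn n) nN) /=; ring.
- by rewrite ltnn exprS; ring.
Qed.

(** The weighted increment [mu1 rho^n incr n] is a nonnegative term plus the tail
    sum over [k > n] of [rho^k (inflated k - inflated_mean)], and beyond [N] the
    extra rate [mu2] alone makes this tail at least [mu1 rho^n]. *)
Lemma incr_ge1 n : 0 <= e -> inflated_mean <= mu1 -> (N <= n)%N -> 1 <= incr n.
Proof.
move=> e_ge0 cmu1 Nn.
have rn_gt0 : 0 < rho ^+ n by rewrite exprn_gt0.
have pos : 0 < (1 - rho) * (mu1 * rho ^+ n).
  by rewrite !mulr_gt0 // subr_gt0.
rewrite -(ler_pM2l pos) mulr1 -[leRHS]mulrA poisson_sum //.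
rewrite inflated_sum leqW // exprS.
have := ler_wpM2l (addr_ge0 ler01 e_ge0) (mean_le_c n.+1).
set A := (1 + e) * \sum_(_ <= _ < _) _.
have : 0 <= (mu1 - inflated_mean) * (rho * rho ^+ n).
  by rewrite mulr_ge0 ?subr_ge0 // mulr_ge0 // ltW.
have -> : (1 - rho) * (mu1 * rho ^+ n) = (mu2 - mu1) * (rho * rho ^+ n).
  by field.
rewrite /inflated_mean; lra.
Qed.

End Inflation.

(** The Lyapunov function is [x1 + g x2 + B], where [g] solves the Poisson
    equation of the saturated second queue for the inflated rates.  In the
    interior its drift is [lambda - inflated + inflated_mean - mu1].  On the
    boundary [x1 = 0] the missing service changes it by [mu1 (1 - a n)], which
    is not positive as soon as [a n >= 1]; only finitely many boundary states
    remain. *)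
Theorem tandem_stable (X : minimal_process (tandem_rate lambda mu1 mu2)) :
  stable X.
Proof.
have c_ge0 : 0 <= c by apply: le_trans (mean_le_c 0); rewrite big_nil.
(* Inflation by [e] and the tail beyond [N] each use a quarter of the gap
   [mu1 - c]; a third quarter pays for the service rates in the total rate. *)
pose e := (mu1 - c) / (4 * (mu1 + mu2)).
have s_gt0 : 0 < mu1 + mu2 by rewrite addr_gt0.
have e_gt0 : 0 < e by rewrite divr_gt0 ?subr_gt0 // mulr_gt0.
have eE : e * (mu1 + mu2) = (mu1 - c) / 4.
  by rewrite /e; field; rewrite gt_eqF.
have [N rhoN] : exists N, mu2 * rho ^+ N.+1 < (mu1 - c) / 4.
  have [||N rhoN] := @expr_small _ rho ((mu1 - c) / 4 / mu2).
  - by rewrite ltW.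
  - by rewrite !divr_gt0 // subr_gt0.
  exists N; rewrite mulrC -ltr_pdivlMr //; apply: le_lt_trans rhoN.
  by rewrite exprS ler_piMl // ?ltW // exprn_gt0.
pose c' := inflated_mean e N.+1.
have c'_lt : c' <= mu1 - (mu1 - c) / 2.
  have : e * c <= e * (mu1 + mu2).
    by rewrite ler_pM2l // ltW // (lt_trans c_lt_mu1) // ltrDl.
  by rewrite /c' /inflated_mean; lra.
have c'_mu1 : c' <= mu1 by move: c_lt_mu1; clearbody c'; lra.
pose a := poisson mu1 mu2 (fun n => c' - inflated e N.+1 n).
pose G n := \sum_(0 <= k < n) a k.
have a_ge1 n : (N < n)%N -> 1 <= a n by apply: incr_ge1 => //; exact: ltW.
have GS n : G n.+1 = G n + a n by rewrite /G big_nat_recr.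
have [|B B_ge0 GB] := @dominating_constant R _ (iota 0 N.+2) (fun n => - G n)
  (fun=> 1) => //.
have GB_ge0 n : 0 <= G n + B.
  have [nN|Nn] := leqP n N.+1.
    by rewrite addrC -lerBlDr sub0r -[B]mulr1 GB // mem_iota.
  rewrite -(subnK (ltnW Nn)); elim: (n - N.+1)%N => [|k IHk].
    by rewrite add0n addrC -lerBlDr sub0r -[B]mulr1 GB // mem_iota leqnn.
  rewrite addSn GS addrAC addr_ge0 // (le_trans ler01) // a_ge1 //.
  exact: leq_addl.
pose U (x : nat * nat) : R := x.1%:R + (G x.2 + B).
pose F := [seq (0%N, n) | n <- iota 0 N.+1].
have mu2_ge0 := ltW mu2_gt0.
apply: (@foster_ergodic _ _ _ X (tandem_succ) (tandem_rmin lambda mu1 mu2)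
  _ _ _ _ _ _ _ U F e) => //.
- exact: tandem_rate_ge0.
- exact: tandem_succ_uniq.
- exact: tandem_succ_irr.
- exact: tandem_rate_succ.
- exact: tandem_rmin_gt0.
- exact: tandem_rminP.
- exact: tandem_connected.
- by move=> x; rewrite addr_ge0.
move=> [x1 n] xF.
rewrite (sum_tandem _ _ _ (fun y => U y - U (x1, n))) tandem_total_rate //=.
have arrival : U (x1.+1, n) - U (x1, n) = 1 by rewrite /U /= -natr1; ring.
have move_on : (0 < x1)%N -> U (x1.-1, n.+1) - U (x1, n) = a n - 1.
  by case: x1 {xF arrival} => // k _; rewrite /U /= GS -natr1; ring.
have departure : (0 < n)%N -> U (x1, n.-1) - U (x1, n) = - a n.-1.
  by case: n {xF arrival move_on} => // k _; rewrite /U /= GS; ring.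
have balance : mu1 * a n - (if (0 < n)%N then mu2 * a n.-1 else 0) =
    c' - inflated e N.+1 n.
  case: n {xF arrival move_on departure} => [|k] /=.
    by rewrite subr0; exact: poisson0.
  by rewrite [mu1 * _]poissonS // addrC addKr.
have rate_le : (if (0 < x1)%N then mu1 else 0) +
               (if (0 < n)%N then mu2 else 0) <= mu1 + mu2.
  by apply: lerD; case: ifP => // _; apply: ltW.
have cost : e * ((if (0 < x1)%N then mu1 else 0) +
               (if (0 < n)%N then mu2 else 0)) <= (mu1 - c) / 4.
  by rewrite -eE ler_pM2l.
have infl : (1 + e) * lambda n <= inflated e N.+1 n.
  by rewrite /inflated lerDl; case: ifP => // _; apply: ltW.
have boundary : ~~ (0 < x1)%N -> 1 <= a n.
  rewrite -eqn0Ngt => /eqP x0; apply: a_ge1; rewrite ltnNge.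
  apply: contra xF => nN; rewrite x0; apply/mapP; exists n => //.
  by rewrite mem_iota.
have -> : (if (0 < n)%N then mu2 * (U (x1, n.-1) - U (x1, n)) else 0) =
    - (if (0 < n)%N then mu2 * a n.-1 else 0).
  by case: ifP => [/departure ->|_]; [rewrite mulrN|rewrite oppr0].
rewrite arrival.
have main : (if (0 < x1)%N then mu1 * (U (x1.-1, n.+1) - U (x1, n)) else 0)
    <= mu1 * a n - mu1.
  case: ifPn => [/move_on ->|/boundary an]; first by rewrite mulrBr mulr1.
  by rewrite subr_ge0 ler_peMr // ltW.
clearbody c' a U e; move: c_lt_mu1 main cost infl balance c'_lt.
rewrite mulr1.
set A1 := (if _ then mu1 * _ else _); set A2 := (if _ then mu1 else _).
set D1 := (if _ then mu2 * _ else _); set D2 := (if _ then mu2 else _).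
clearbody A1 A2 D1 D2; set I := inflated _ _ _; clearbody I.
move=> h1 h2 h3 h4 h5 h6.
have h7 : lambda n + A1 - D1 <= - (e * lambda n) - (mu1 - c) / 4.
  lra.
lra.
Qed.

End Stability.

(** * Instability above the threshold *)

Section Instability.
Variables (R : realType) (lambda : nat -> R) (mu1 mu2 : R) (K : nat).
Hypothesis lambda_ge0 : forall n, 0 <= lambda n.
Hypothesis lambda0_gt0 : 0 < lambda 0%N.
Hypothesis mu1_gt0 : 0 < mu1.
Hypothesis mu1_lt_mu2 : mu1 < mu2.

Local Notation rho := (mu1 / mu2).
Local Notation S :=
  (\sum_(0 <= k < K.+1) lambda k * ((1 - rho) * rho ^+ k)).

Hypothesis mean_gt : mu1 < S.

Let mu2_gt0 : 0 < mu2 := lt_trans mu1_gt0 mu1_lt_mu2.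
Let mu2_neq0 : mu2 != 0 := lt0r_neq0 mu2_gt0.

Let eta := (S - mu1) / 2.
Let eta_gt0 : 0 < eta. Proof. by rewrite divr_gt0 // subr_gt0. Qed.
(** The superharmonic function is
    [W (x1, n) = (1 + t)^- x1 * \prod_(k < n) (1 + t * a k)] for a small [t].
    Arrivals decrease [W], so that those beyond [K] can be discarded in its
    drift, as [l] does, and [a] can be kept constant from [K] on.  The surplus
    of the mean arrival rate over [mu1] is shared, by [eta], between a negative
    drift up to [K] and a large enough last increment. *)
Let a n := poisson mu1 mu2 (fun k => lambda k - mu1 - eta) (minn n K).
Let l n := if (n <= K)%N then lambda n else 0.
Let b n := if n is m.+1 then a m else 0.

(** Without arrivals and for a constant increment [s], as beyond [K], the drift
    of [W] in the interior is [mu1 (1 + s) - mu2 s] to first order in [t]. *)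
Lemma last_incr : mu1 < (mu2 - mu1) * a K.
Proof.
have rho_gt0 : 0 < rho by rewrite divr_gt0.
have r_gt0 : 0 < rho ^+ K by rewrite exprn_gt0.
have E : (1 - rho) * (mu1 * rho ^+ K * a K) =
    S - (mu1 + eta) * (1 - rho ^+ K.+1).
  rewrite /a minnn poisson_sum //; elim: K.+1 => [|n IHn].
    by rewrite !big_nil expr0 subrr !mulr0 subr0.
  by rewrite !big_nat_recr //= mulrDr IHn exprS; field.
have rr : 0 < eta * (rho * rho ^+ K).
  exact: mulr_gt0 eta_gt0 (mulr_gt0 rho_gt0 r_gt0).
have E2 : (1 - rho) * (mu1 * rho ^+ K * a K) =
   (rho * rho ^+ K) * ((mu2 - mu1) * a K).
  by field.
rewrite -(ltr_pM2l (mulr_gt0 rho_gt0 r_gt0)) -E2 E exprS.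
have : eta + eta = S - mu1 by rewrite /eta; field.
move: rr mean_gt; lra.
Qed.

Lemma last_incr_gt0 : 0 < a K.
Proof.
by have := lt_trans mu1_gt0 last_incr; rewrite pmulr_rgt0 // subr_gt0.
Qed.

Lemma drift_neg n : - l n + mu1 * (1 + a n) - mu2 * b n < 0.
Proof.
rewrite /l; case: leqP => [nK|Kn].
  case: n nK => [_|n nK] /=.
    by rewrite /a min0n mulrDr poisson0 //; move: eta_gt0; lra.
  rewrite /a (minn_idPl nK) (minn_idPl (ltnW nK)) mulrDr poissonS //.
  by move: eta_gt0; lra.
case: n Kn => // n; rewrite ltnS => Kn.
rewrite /b /a (minn_idPr Kn) (minn_idPr (leqW Kn)).
by have := last_incr; rewrite /a minnn; lra.
Qed.

(** The drift of [W] relative to [W], multiplied by [(1 + t) (1 + t * b n) / t],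
    is a cubic polynomial in [t] whose constant term is negative by [drift_neg].
    It does not depend on [n] beyond [K], so finitely many thresholds suffice. *)
Lemma small_perturbation : exists2 t : R, 0 < t & forall n, 0 < 1 + t * b n /\
  - l n * (1 + t * b n) + mu1 * (1 + a n + t * a n) * (1 + t) * (1 + t * b n)
  - mu2 * b n * (1 + t) <= 0.
Proof.
pose P n t := 0 < 1 + t * b n /\
  - l n * (1 + t * b n) + mu1 * (1 + a n + t * a n) * (1 + t) * (1 + t * b n)
  - mu2 * b n * (1 + t) <= 0.
have [|d d_gt0 Pd] := @common_threshold R _ (iota 0 K.+2) P.
  move=> n _.
  have [d1 d1_gt0 H1] := cubic_neg_near0 (- b n) 0 0 (ltrN10 R).
  have [d2 d2_gt0 H2] := cubic_neg_near0
    (- l n * b n + mu1 * (a n + (1 + a n) * (1 + b n)) - mu2 * b n)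
    (mu1 * (a n * (1 + b n) + (1 + a n) * b n)) (mu1 * a n * b n) (drift_neg n).
  exists (Num.min d1 d2) => [|t t_gt0]; first by rewrite lt_min d1_gt0.
  rewrite le_min => /andP[/(H1 t t_gt0) h1 /(H2 t t_gt0) h2]; split.
    by move: h1; rewrite !mul0r; lra.
  apply: ltW; apply: le_lt_trans h2; rewrite le_eqVlt; apply/orP; left.
  by apply/eqP; ring.
exists d => // n; have [nK|Kn] := leqP n K.+1.
  by apply: Pd => //; rewrite mem_iota.
have [-> -> ->] : [/\ b n = b K.+1, l n = l K.+1 & a n = a K.+1].
  case: n Kn => // n; rewrite ltnS => Kn.
  split; first by rewrite /b /a minnn (minn_idPr (ltnW Kn)).
    rewrite /l [(n.+1 <= K)%N]leqNgt [(K.+1 <= K)%N]leqNgt ltnSn.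
    by rewrite !leqW // ltnW.
  by rewrite /a (minn_idPr (leqnSn K)) (minn_idPr _) // leqW // ltnW.
by apply: Pd => //; rewrite mem_iota leqnn.
Qed.

(** [W] is superharmonic off the boundary states [F] with [x2 <= K], where it is
    bounded below, and tends to 0 along [(k, 0)].  Since [lambda 0 > 0], arrivals
    alone lead from the empty state to such a [(k, 0)], from which [W] is too
    small for a return to [F] to be certain. *)
Theorem tandem_unstable (X : minimal_process (tandem_rate lambda mu1 mu2)) :
  ~ stable X.
Proof.
have [t t_gt0 Ht] := small_perturbation.
have t1 : 0 < 1 + t by rewrite addr_gt0.
have t1_neq0 := lt0r_neq0 t1.
pose G n := \prod_(0 <= k < n) (1 + t * a k).
have s_gt0 k : 0 < 1 + t * a k by case: (Ht k.+1).
have G_gt0 n : 0 < G n by apply: prodr_gt0.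
have GS n : G n.+1 = G n * (1 + t * a n) by rewrite /G big_nat_recr.
pose W (x : nat * nat) := (1 + t)^-1 ^+ x.1 * G x.2.
have W_gt0 x : 0 < W x by rewrite mulr_gt0 // exprn_gt0 // invr_gt0.
pose F : set (nat * nat) := [set x | x.1 = 0%N /\ (x.2 <= K)%N].
have [|M M_ge0 HM] := @dominating_constant R _ (iota 0 K.+1) (fun=> 1) G => //.
have M_gt0 : 0 < M.
  rewrite lt_neqAle M_ge0 andbT; apply/eqP => M0.
  by have := HM 0%N (mem_head _ _); rewrite -M0 mul0r ler10.
have WF x : F x -> M^-1 <= W x.
  case: x => [x1 n] [/= -> nK]; rewrite /W expr0 mul1r -div1r ler_pdivrMr //.
  by rewrite mulrC HM // mem_iota.
have [||k hk] := @expr_small R (1 + t)^-1 M^-1.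
- by rewrite invr_ge0 ltW //= invf_lt1 // ltrDl.
- by rewrite invr_gt0.
have rate_gt0 x := lt_le_trans (tandem_rmin_gt0 lambda0_gt0 mu1_gt0 mu2_gt0)
  (tandem_rminP lambda_ge0 mu1_gt0 mu2_gt0 x).
have q_ge0 := tandem_rate_ge0 lambda_ge0 mu1_gt0 mu2_gt0.
have q_succ := @tandem_rate_succ R lambda mu1 mu2.
have superharmonic x : ~ F x ->
    mean (jump_prob (tandem_rate lambda mu1 mu2)) tandem_succ W x <= W x.
  move=> xF; rewrite -[leRHS]subr0.
  apply: (mean_drift q_ge0 tandem_succ_uniq tandem_succ_irr q_succ rate_gt0).
  rewrite oppr0 mul0r (sum_tandem _ _ _ (fun y => W y - W x)).
  case: x xF => x1 n xF /=; pose u := 1 + t * b n.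
  have [u_gt0 phi] := Ht n; rewrite -/u in u_gt0 phi.
  have u_neq0 := lt0r_neq0 u_gt0.
  have -> : W (x1.+1, n) - W (x1, n) = W (x1, n) * ((1 + t)^-1 - 1).
    by rewrite /W /= exprS; ring.
  have -> : (if (0 < n)%N then mu2 * (W (x1, n.-1) - W (x1, n)) else 0) =
      mu2 * (W (x1, n) * (u^-1 - 1)).
    rewrite /u; case: n {xF u u_gt0 u_neq0 phi} => [|n] /=.
      by rewrite mulr0 addr0 invr1 subrr !mulr0.
    by rewrite /W /= GS; field; rewrite lt0r_neq0.
  have wpos := W_gt0 (x1, n).
  have [x1_gt0|] := boolP (0 < x1)%N; last first.
    rewrite -eqn0Ngt => /eqP x1_0.
    have nK : (K < n)%N by rewrite ltnNge; apply/negP => nK; apply: xF.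
    have u_ge1 : 1 <= u.
      rewrite /u lerDl mulr_ge0 // ?(ltW t_gt0) //.
      case: n {xF u u_gt0 u_neq0 phi wpos} nK => // n; rewrite ltnS => nK.
      rewrite /b /a (minn_idPr nK) -{1}(minnn K); exact: ltW last_incr_gt0.
    have le_inv (s : R) : 1 <= s -> s^-1 - 1 <= 0.
      move=> s1; rewrite subr_le0 invf_le1 //; exact: lt_le_trans s1.
    rewrite addr0 -[leRHS]addr0 lerD // mulr_ge0_le0 ?(ltW mu2_gt0) //.
      by rewrite mulr_ge0_le0 ?(ltW wpos) // le_inv // lerDl ltW.
    by rewrite mulr_ge0_le0 ?(ltW wpos) // le_inv.
  have -> : W (x1.-1, n.+1) - W (x1, n) =
      W (x1, n) * ((1 + t) * (1 + t * a n) - 1).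
    case: x1 x1_gt0 {xF wpos} => // i _; rewrite /W /= GS exprS; field.
    exact: t1_neq0.
  (* Up to a nonnegative factor, the drift is the polynomial bounded by [phi],
     with [lambda n] for [l n]. *)
  rewrite [leLHS](_ : _ = W (x1, n) * t / ((1 + t) * u) *
    (- lambda n * u + mu1 * (1 + a n + t * a n) * (1 + t) * u
     - mu2 * b n * (1 + t))); last first.
    by rewrite /u; field; rewrite u_neq0.
  rewrite mulr_ge0_le0 //.
    by rewrite divr_ge0 // ltW // mulr_gt0.
  apply: le_trans phi; rewrite lerD2r lerD2r ler_pM2r // lerN2 /l.
  by case: ifP.
move=> [_ /(_ (0%N, 0%N))] [r0|].
  by have := rate_gt0 (0%N, 0%N); rewrite r0 ltxx.
rewrite (superharmonic_not_positive_recurrent X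
  (jump_prob_ge0 q_ge0 rate_gt0) tandem_succ_uniq
  (sum_jump_prob q_ge0 tandem_succ_uniq tandem_succ_irr q_succ rate_gt0)
  (F := F) (W := W) (m := M^-1) (y := fun i => (i, 0%N)) (k := k)) //.
- by rewrite invr_gt0.
- by move=> x; exact: ltW.
- by move=> i /andP[i_gt0 _]; rewrite xpair_eqE eqxx andbT -lt0n.
- move=> i _; rewrite (jump_probE tandem_succ_irr rate_gt0) ?mem_head //.
  by rewrite divr_gt0 // /tandem_rate eqxx.
- by rewrite /W /= /G big_geq // mulr1.
Qed.

End Instability.

(** * The threshold *)

Lemma expectation_geom (R : realType) (z : R) d (T : measurableType d)
    (P : probability T R) (Z : {RV P >-> nat}) (f : nat -> R) :
  geom z Z -> (forall n, 0 <= f n) ->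
  ('E_P[fun w => f (Z w)] =
   \sum_(n <oo) (f n * ((1 - z) * z ^+ n))%:E)%E.
Proof.
move=> Z_geom f_ge0; rewrite unlock.
have mZ n : measurable [set w | Z w = n].
  rewrite (_ : mkset _ = Z @^-1` [set n]) // -[X in measurable X]setTI.
  exact: measurable_funPT.
transitivity
  (\int[P]_w (\sum_(n <oo) (f n)%:E * (\1_[set w | Z w = n] w)%:E)%E)%E.
  apply: eq_integral => w _; rewrite (@nneseriesD1 _ _ (Z w)) //; last first.
    by move=> n _; rewrite -EFinM lee_fin mulr_ge0.
  rewrite eseries0 => [|n _ nZ]; rewrite indicE.
    by rewrite mem_set // mule1 adde0.
  by rewrite memNset ?mule0 // => Zn; rewrite /= Zn eqxx in nZ.
rewrite integral_nneseries //; last 2 first.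
- move=> n; apply: emeasurable_funM => //.
  exact/measurable_EFinP/measurable_indic.
- by move=> n w _; rewrite -EFinM lee_fin mulr_ge0.
apply: eq_eseriesr => n _.
rewrite ge0_integralZl_EFin //.
  by rewrite integral_indic // setIT [X in (_ * X)%E]Z_geom.
exact/measurable_EFinP/measurable_indic.
Qed.

Theorem theorem3 (R : realType) (lambda : nat -> R) (mu1 mu2 : R)
    (lambda_ge0 : forall n : nat, 0 <= lambda n) (lambda0_gt0 : 0 < lambda 0%N)
    (mu1_gt0 : 0 < mu1) (mu2_gt0 : 0 < mu2) (mu1_lt_mu2 : mu1 < mu2)
    (d : measure_display) (T : measurableType d) (P : probability T R)
    (Z : {RV P >-> nat}) (Z_geom : geom (mu1 / mu2) Z)
    (X : minimal_process (tandem_rate lambda mu1 mu2)) :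
  (('E_P[fun w => lambda (Z w)] < mu1%:E)%E -> stable X) /\
  ((mu1%:E < 'E_P[fun w => lambda (Z w)])%E -> ~ stable X).
Proof.
pose u k := (lambda k * ((1 - mu1 / mu2) * (mu1 / mu2) ^+ k))%:E.
have rho_le1 : mu1 / mu2 <= 1 by rewrite ler_pdivrMr // mul1r ltW.
have u_ge0 k : (0 <= u k)%E.
  by rewrite lee_fin !mulr_ge0 ?subr_ge0 // exprn_ge0 // divr_ge0 // ltW.
rewrite (expectation_geom Z_geom lambda_ge0) -/u; split=> [lt_mu1|gt_mu1].
  have fin : (\sum_(k <oo) u k)%E \is a fin_num.
    rewrite ge0_fin_numE ?(lt_trans lt_mu1 (ltry _)) //.
    by apply: nneseries_ge0 => k _ _; exact: u_ge0.
  apply: (@tandem_stable _ _ _ _ (fine (\sum_(k <oo) u k)%E)) => // [|n].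
    by rewrite -lte_fin fineK.
  rewrite -lee_fin fineK // -sumEFin; apply: nneseries_lim_ge => k _ _.
  exact: u_ge0.
have [K gtK] : exists K, (mu1%:E < \sum_(0 <= k < K) u k)%E.
  apply: contrapT => no_K; move: gt_mu1; rewrite ltNge => /negP; apply.
  apply: nneseries_le_bound => // n; rewrite leNgt; apply/negP => gt_n.
  by apply: no_K; exists n.
apply: (@tandem_unstable _ _ _ _ K) => //; rewrite -lte_fin -sumEFin.
by apply: lt_le_trans gtK _; rewrite big_nat_recr //= leeDl // u_ge0.
Qed.
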